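(* Let $n\geq 3$ and let $G$ be a unicyclic graph of order $n$. Then $$ASO(G)\leq (n-3)\sqrt{n+\frac{2}{n-2}}+2\sqrt{n-1+\frac{4}{n-1}}+2,$$ with equality if and only if $G\cong S'_n$, where $S'_n$ denotes the unique unicyclic graph of order $n$ with maximum degree $n-1$ (the graph obtained from the star $K_{1,n-1}$ by adding one edge joining two of its pendant vertices).
   Context: All graphs are finite and simple. A unicyclic graph is a connected graph whose number of edges equals its number of vertices. For a graph $G$ with no connected component isomorphic to the path $P_2$ on two vertices, the augmented Sombor index is $ASO(G)=\sum_{v_iv_j\in E(G)}\sqrt{\frac{d_i^2+d_j^2}{d_i+d_j-2}}$, where $d_i$ denotes the degree of vertex $v_i$ in $G$ and the sum runs over all edges of $G$. *)

(* Defs.v *)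
From mathcomp Require Import all_boot all_order all_algebra.
From mathcomp Require Import reals.

Set Implicit Arguments.
Unset Strict Implicit.
Unset Printing Implicit Defensive.

Import Order.TTheory GRing.Theory Num.Theory.
Local Open Scope ring_scope.

Record sgraph := SGraph {
  vertex :> finType;
  adj : rel vertex;
  adj_sym : symmetric adj;
  adj_irr : irreflexive adj
}.

Definition edges (G : sgraph) : {set {set G}} :=
  [set [set p.1; p.2] | p : G * G & adj p.1 p.2].

Definition deg (G : sgraph) (v : G) : nat := #|[set w | adj v w]|.

Definition connected (G : sgraph) : Prop :=
  (0 < #|G|)%N /\ forall u v : G, connect (@adj G) u v.

Definition unicyclic (G : sgraph) : Prop :=
  connected G /\ #|edges G| = #|G|.

Definition isomorphic (G H : sgraph) : Prop :=
  exists2 f : G -> H, bijective f & forall u v, adj (f u) (f v) = adj u v.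

(* An edge is a two-element set A = {v_i, v_j}, so the inner sums are
   d_i^2 + d_j^2 and d_i + d_j; the subtraction of 2 is carried out in R.
   On a P_2 component the denominator vanishes and the term takes the junk
   value 0; such graphs are outside the domain of the index. *)
Definition ASO (R : realType) (G : sgraph) : R :=
  \sum_(A in edges G)
    Num.sqrt ((\sum_(v in A) (deg v)%:R ^+ 2)
              / ((\sum_(v in A) (deg v)%:R) - 2)).

(* The star has centre 0 and the extra edge joins the leaves 1 and 2. *)
Definition star_plus_adj (n : nat) : rel 'I_n := fun i j =>
  [|| (i == 0 :> nat) && (j != 0 :> nat), (j == 0 :> nat) && (i != 0 :> nat),
      (i == 1 :> nat) && (j == 2 :> nat) | (j == 1 :> nat) && (i == 2 :> nat)]%N.

Fact star_plus_adj_sym n : symmetric (@star_plus_adj n).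
Proof.
by move=> i j; rewrite /star_plus_adj orbCA; do 2!congr (_ || _); rewrite orbC.
Qed.

Fact star_plus_adj_irr n : irreflexive (@star_plus_adj n).
Proof. by case=> [[|[|[|i]]] lti]. Qed.

Definition star_plus (n : nat) : sgraph :=
  SGraph (@star_plus_adj_sym n) (@star_plus_adj_irr n).

(* Main.v *)
Require Import Defs.
From mathcomp Require Import all_boot all_order all_algebra.
From mathcomp Require Import reals.
From mathcomp Require Import zify ring lra.

Set Implicit Arguments.
Unset Strict Implicit.
Unset Printing Implicit Defensive.

Import Order.TTheory GRing.Theory Num.Theory.
Local Open Scope ring_scope.

(* The edge of degrees a, b weighs sqrt ((a^2 + b^2) / (a + b - 2)), which over
   1 <= a, b <= D (with D >= 3) is largest at (1, D).  If some vertex has degree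
   n - 1, exactly one edge avoids it, so G is S'_n.  If the maximum degree is
   n - 2, exactly two edges avoid a vertex of maximum degree, so all other
   degrees are at most 3 and these two edges weigh at most sqrt 5 each; if it is
   at most n - 3, n times the weight of (1, n - 3) is already below the bound.
   Small cases have all degrees at most 2, hence equal to 2 by the handshake
   identity, and then ASO(G) = 2n. *)

(** * The weight of an edge as a function of its end degrees *)

Definition edge_weight (R : realType) (a b : nat) : R :=
  Num.sqrt ((a%:R ^+ 2 + b%:R ^+ 2) / (a%:R + b%:R - 2)).

Section EdgeWeight.
Variable R : realType.
Local Notation w := (edge_weight R).

Lemma edge_weightC a b : w a b = w b a.
Proof. by rewrite /edge_weight addrC [a%:R + _]addrC. Qed.

Lemma edge_weight_ge0 a b : 0 <= w a b.
Proof. exact: sqrtr_ge0. Qed.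

Lemma edge_weight22 : w 2 2 = 2.
Proof.
rewrite /edge_weight.
have -> : (2%:R ^+ 2 + 2%:R ^+ 2) / (2%:R + 2%:R - 2) = 2%:R ^+ 2 :> R by field.
by rewrite sqrtr_sqr ger0_norm.
Qed.

(* With p = a - 1, q = b - 1, E = D - 1 the difference of the two sides is
   E p (E - p) + E q (E - q) + 2 (p + q) - 2 E; if p + q < E then p (E - p)
   or q (E - q) is at least E - 1, and E (E - 1) + 2 >= 2 E. *)
Lemma edge_weight_num_le a b D : (0 < a <= D)%N -> (0 < b <= D)%N ->
    (2 < a + b)%N -> (2 < D)%N ->
  ((a ^ 2 + b ^ 2) * (D - 1) <= (D ^ 2 + 1) * (a + b - 2))%N.
Proof.
case: a b D => [//|p] [//|q] [//|E] /=; rewrite !ltnS => pE qE pq E2.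
rewrite !subn1 /= (_ : p.+1 + q.+1 - 2 = p + q)%N; last by lia.
have [pqE|pqE] := leqP E (p + q).
  have : (E * (p * p + q * q) <= E * (p * E + q * E))%N.
    by rewrite leq_mul2l leq_add ?orbT // leq_mul2l ?pE ?qE orbT.
  rewrite !expnS !expn0; nia.
have H r s : (0 < r)%N -> (r + s < E)%N ->
  ((r.+1 ^ 2 + s.+1 ^ 2) * E <= (E.+1 ^ 2 + 1) * (r + s))%N.
  move=> r0 rs.
  have h1 : (r * r + E <= r * E + 1)%N by nia.
  have h2 : (s * s <= s * E)%N by nia.
  have h3 : (E * (r * r + E + s * s) <= E * (r * E + 1 + s * E))%N.
    by rewrite leq_mul2l leq_add ?orbT.
  rewrite !expnS !expn0; nia.
case: (posnP p) => [p0|p0]; last exact: H.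
rewrite [(_ ^ 2 + _)%N]addnC [(p + q)%N]addnC; apply: H; last by rewrite addnC.
by move: pq; rewrite p0; case: q {qE pqE}.
Qed.

Lemma edge_weight_le a b D : (0 < a <= D)%N -> (0 < b <= D)%N -> (2 < D)%N ->
  w a b <= w 1 D.
Proof.
move=> ha hb hD; have [h2|h2] := leqP (a + b) 2.
  (* Here a = b = 1: the denominator vanishes and the weight takes the junk value 0. *)
  rewrite (_ : w a b = 0) ?edge_weight_ge0 //.
  have [-> ->] : a = 1%N /\ b = 1%N by lia.
  by rewrite /edge_weight subrr invr0 mulr0 sqrtr0.
apply: ler_wsqrtr.
have hDR : (3 : R) <= D%:R by rewrite (ler_nat R 3).
have habR : (3 : R) <= a%:R + b%:R by rewrite -natrD (ler_nat R 3).
rewrite ler_pdivrMr ?subr_gt0; last by lra.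
rewrite mulrAC ler_pdivlMr; last by lra.
have := edge_weight_num_le ha hb h2 hD.
rewrite -(ler_nat R) !natrM !natrD !natrX !natrB ?natrD; [|by lia..].
by move=> h; lra.
Qed.

Lemma edge_weight13 : w 1 3 = Num.sqrt 5.
Proof. by rewrite /edge_weight; congr Num.sqrt; field. Qed.

Lemma edge_weight1_sqr (d : nat) : (1 < d)%N ->
  w 1 d ^+ 2 = d%:R + 1 + 2 / (d%:R - 1).
Proof.
move=> d1; have h : (2 : R) <= d%:R by rewrite (ler_nat R 2).
rewrite sqr_sqrtr; first by field; lra.
by apply: divr_ge0; [rewrite addr_ge0 ?sqr_ge0 | lra].
Qed.

Lemma edge_weight2_sqr (d : nat) : (0 < d)%N ->
  w 2 d ^+ 2 = d%:R + 4 / d%:R.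
Proof.
move=> d1; have h : (1 : R) <= d%:R by rewrite (ler_nat R 1).
rewrite sqr_sqrtr; first by field; lra.
by apply: divr_ge0; [rewrite addr_ge0 ?sqr_ge0 | lra].
Qed.

(** With n = [m.+3], this lemma and the next identify the two radicals of the bound as weights of
    edges at the centre of S'_n, whose other end has degree 1 or 2. *)
Lemma edge_weight1E (m : nat) :
  w 1 m.+2 = Num.sqrt (m.+3%:R + 2 / (m.+3%:R - 2)).
Proof.
have hm : (0 : R) <= m%:R by exact: ler0n.
by rewrite /edge_weight -(addn3 m) -(addn2 m) !natrD; congr Num.sqrt; field; lra.
Qed.

Lemma edge_weight2E (m : nat) :
  w 2 m.+2 = Num.sqrt (m.+3%:R - 1 + 4 / (m.+3%:R - 1)).
Proof.
have hm : (0 : R) <= m%:R by exact: ler0n.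
by rewrite /edge_weight -(addn3 m) -(addn2 m) !natrD; congr Num.sqrt; field; lra.
Qed.

Lemma edge_weight1_homo (d e : nat) : (2 < d)%N -> (d <= e)%N ->
  w 1 d <= w 1 e.
Proof. by move=> d2 de; apply: edge_weight_le => //; lia. Qed.

(** After squaring, what remains is 2 / (d - 1) <= 4 / (d + 1), that is d >= 3. *)
Lemma le_edge_weight12 (d : nat) : (2 < d)%N -> w 1 d <= w 2 d.+1.
Proof.
move=> d2; have hd : (3 : R) <= d%:R by rewrite (ler_nat R 3).
rewrite -(@ler_pXn2r _ 2) ?nnegrE ?edge_weight_ge0 //.
rewrite edge_weight1_sqr ?edge_weight2_sqr // 1?ltnW // -[d.+1%:R]natr1 lerD2l.
rewrite ler_pdivrMr; last by lra.
rewrite mulrAC ler_pdivlMr; last by lra.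
by lra.
Qed.

Lemma edge_weight2_gt2 (d : nat) : (2 < d)%N -> 2 < w 2 d.
Proof.
move=> d2; have hd : (3 : R) <= d%:R by rewrite (ler_nat R 3).
rewrite -(@ltr_pXn2r _ 2) ?nnegrE ?edge_weight_ge0 //.
rewrite edge_weight2_sqr 1?ltnW 1?ltnW //.
have : 0 < (d%:R - 2) ^+ 2 / d%:R :> R by rewrite divr_gt0 ?exprn_gt0; lra.
have -> : (d%:R - 2) ^+ 2 / d%:R = d%:R + 4 / d%:R - 4 :> R by field; lra.
by move=> h; lra.
Qed.

(** * Numerical comparison of the case bounds with the extremal value *)

Lemma edge_weight1_ge_sqrt5 (d : nat) : (2 < d)%N -> Num.sqrt 5 <= w 1 d.
Proof. by move=> d2; rewrite -edge_weight13 edge_weight1_homo. Qed.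

Lemma sqrt5_bounds : 2236 / 1000 <= Num.sqrt (5 : R) <= 2237 / 1000.
Proof.
have h0 : 0 <= Num.sqrt 5 :> R by exact: sqrtr_ge0.
have h : Num.sqrt 5 ^+ 2 = 5 :> R by rewrite sqr_sqrtr.
by apply/andP; split; nra.
Qed.

(* [A > g + (g - 2) / m] for [g = w 1 m], [A = w 1 (m + 2)]. *)
Lemma bound_gt_small_deg (m : nat) : (2 < m)%N ->
  (m%:R + 3) * w 1 m < m%:R * w 1 m.+2 + 2 * w 2 m.+2 + 2.
Proof.
move=> m2; have hm : (3 : R) <= m%:R by rewrite (ler_nat R 3).
have hg2 := edge_weight1_sqr (ltnW m2).
have hA2 := edge_weight1_sqr (isT : 1 < m.+2)%N.
have hg5 := edge_weight1_ge_sqrt5 m2.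
have /andP[h5 _] := sqrt5_bounds.
have hC : w 1 m <= w 2 m.+2.
  by apply: le_trans (@le_edge_weight12 m.+1 (ltnW m2)); exact: edge_weight1_homo.
have hA0 := edge_weight_ge0 1 m.+2.
move: hC hA0 hg2 hA2 hg5; set C := w 2 _; set A := w 1 _.+2; set g := w 1 m.
move=> hC hA0 hg2 hA2 hg5.
(* Replacing C by g through [hC] cancels two of the m + 3 copies of g. *)
suff : (m%:R + 1) * g - 2 < m%:R * A by move=> h; lra.
have hi : 2 / (m%:R - 1) <= 1 :> R by rewrite ler_pdivrMr; lra.
have hj : 0 <= 2 / (m%:R + 1) :> R by rewrite divr_ge0; lra.
rewrite -(@ltr_pXn2r _ 2) ?nnegrE ?mulr_ge0 //; last by nra.
rewrite exprMn hA2 -[m.+2%:R]natr1 -[m.+1%:R]natr1.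
have -> : m%:R + 1 + 1 + 1 + 2 / (m%:R + 1 + 1 - 1) = m%:R + 3 + 2 / (m%:R + 1) :> R.
  by field; lra.
have -> : ((m%:R + 1) * g - 2) ^+ 2
   = (m%:R + 1) ^+ 2 * g ^+ 2 - 4 * (m%:R + 1) * g + 4 by ring.
have hmi : (m%:R - 1) * (2 / (m%:R - 1)) = 2 :> R by field; lra.
rewrite hg2; move: hi hj hmi; set i := 2 / (_ - 1); set j := 2 / _.
move=> hi hj hmi.
have hgm : (m%:R + 1) * (2236 / 1000) <= (m%:R + 1) * g.
  by apply: ler_wpM2l; lra.
have hmj : 0 <= m%:R ^+ 2 * j by rewrite mulr_ge0 ?sqr_ge0.
(* Since (m + 1)^2 = (m + 3) (m - 1) + 4, this form clears the denominator of [i] up to 4 i <= 4.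
   The cubic and quadratic terms in m then cancel, and 4 (m + 1) g with g >= 2.236 outweighs the
   linear rest. *)
have -> : (m%:R + 1) ^+ 2 * (m%:R + 1 + i) = (m%:R + 1) ^+ 3
    + (m%:R + 3) * ((m%:R - 1) * i) + 4 * i by ring.
by rewrite hmi; lra.
Qed.

Lemma bound_gt_large_deg (m : nat) : (1 < m)%N ->
  (m%:R + 1) * w 1 m.+1 + 2 * Num.sqrt 5
    < m%:R * w 1 m.+2 + 2 * w 2 m.+2 + 2.
Proof.
move=> m1; have /andP[h5l h5u] := sqrt5_bounds.
have hG2 := edge_weight1_sqr (ltnW m1 : 1 < m.+1)%N.
have hA2 := edge_weight1_sqr (isT : 1 < m.+2)%N.
have hC2 := edge_weight2_sqr (isT : 0 < m.+2)%N.
have hG0 := edge_weight_ge0 1 m.+1.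
have hA0 := edge_weight_ge0 1 m.+2.
have hC0 := edge_weight_ge0 2 m.+2.
have hGA : w 1 m.+1 <= w 1 m.+2 by exact: edge_weight1_homo.
have hGC : w 1 m.+1 <= w 2 m.+2 by exact: le_edge_weight12.
have [m4|m4] := leqP 4 m.
  have hm : (4 : R) <= m%:R by rewrite (ler_nat R 4).
  (* By [hGA] and [hGC] the right side is at least (m + 2) [w 1 m.+1] + 2, so it suffices that
     [w 1 m.+1] exceeds 2 sqrt 5 - 2, which is below 2.48. *)
  suff : 248 / 100 < w 1 m.+1.
    move=> h; have : m%:R * w 1 m.+1 <= m%:R * w 1 m.+2 by apply: ler_wpM2l.
    by lra.
  have : 65 / 10 <= w 1 m.+1 ^+ 2.
    rewrite hG2 -[m.+1%:R]natr1 addrK -subr_ge0.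
    have -> : m%:R + 1 + 1 + 2 / m%:R - 65 / 10
        = (m%:R - 4) * (m%:R - 1 / 2) / m%:R :> R by field; lra.
    by rewrite divr_ge0 ?mulr_ge0 //; lra.
  by move=> h; nra.
(* For m = 2 and m = 3 that sufficient condition fails; decimal estimates of the explicit radicals
   decide. *)
move: hG2 hA2 hC2 hG0 hA0 hC0 hGC {hGA}; case: m m1 m4 => [|[|[|[|//]]]] // _ _.
  have -> : 3%:R + 1 + 2 / (3%:R - 1) = 5 :> R by field.
  have -> : 4%:R + 1 + 2 / (4%:R - 1) = 17 / 3 :> R by field.
  have -> : 4%:R + 4 / 4%:R = 5 :> R by field.
  move=> G2 A2 C2 G0 A0 C0 GC.
  have hG : w 1 3 <= 2237 / 1000 by nra.
  have hA : 238 / 100 <= w 1 4 by nra.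
  by lra.
have -> : 4%:R + 1 + 2 / (4%:R - 1) = 17 / 3 :> R by field.
have -> : 5%:R + 1 + 2 / (5%:R - 1) = 65 / 10 :> R by field.
have -> : 5%:R + 4 / 5%:R = 58 / 10 :> R by field.
move=> G2 A2 C2 G0 A0 C0 _.
have hG : w 1 4 <= 239 / 100 by nra.
have hA : 254 / 100 <= w 1 5 by nra.
have hC : 24 / 10 <= w 2 5 by nra.
by lra.
Qed.

Lemma bound_gt_cycle (m : nat) : (0 < m)%N ->
  2 * (m%:R + 3) < m%:R * w 1 m.+2 + 2 * w 2 m.+2 + 2.
Proof.
move=> m0; have hC := edge_weight2_gt2 (m0 : 2 < m.+2)%N.
have /andP[h5 _] := sqrt5_bounds.
have hA := edge_weight1_ge_sqrt5 (m0 : 2 < m.+2)%N.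
have : m%:R * 2 <= m%:R * w 1 m.+2 by apply: ler_wpM2l => //; lra.
by lra.
Qed.

End EdgeWeight.

(** * Incidence counting and the splitting of the index at a vertex *)

Section Edges.
Variable G : sgraph.
Implicit Types (x y u v : G) (A : {set G}).

Lemma adj_neq u v : adj u v -> u != v.
Proof. by apply: contraTneq => ->; rewrite adj_irr. Qed.

Lemma edgesP A :
  reflect (exists u v, adj u v /\ A = [set u; v]) (A \in edges G).
Proof.
apply: (iffP imsetP) => [[[u v]]|[u [v [uv ->]]]].
  by rewrite inE /= => uv ->; exists u, v.
by exists (u, v); rewrite ?inE.
Qed.

Lemma mem_edges u v : ([set u; v] \in edges G) = adj u v.
Proof.
apply/edgesP/idP => [[a [b [ab /setP e]]]|uv]; last by exists u, v.
have nab := adj_neq ab.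
(* Evaluation at the four points puts u and v in {a, b}, and rules out u = v, which would miss one
   of the distinct a, b. *)
have := e a; have := e b; have := e u; have := e v; rewrite !inE !eqxx !orbT /=.
move=> /esym/orP[]/eqP -> /esym/orP[]/eqP -> => [||//|].
- by rewrite !orbb (eq_sym b) (negPf nab).
- by rewrite adj_sym.
- by rewrite !orbb (negPf nab).
Qed.

Definition incident x : {set {set G}} := [set A in edges G | x \in A].

Lemma incidentE x : incident x = [set [set x; y] | y in [set y | adj x y]].
Proof.
apply/setP => A; rewrite inE; apply/andP/imsetP.
  case=> /edgesP[u [v [uv ->]]]; rewrite !inE => /orP[]/eqP->.
    by exists v; rewrite ?inE.
  by exists u; rewrite 1?setUC // inE adj_sym.
by case=> y; rewrite inE => xy ->; rewrite mem_edges !inE eqxx.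
Qed.

Lemma set2_adj_inj x : {in [set y | adj x y] &, injective (fun y => [set x; y])}.
Proof.
move=> y z; rewrite !inE => xy _ /setP/(_ y); rewrite !inE eqxx orbT.
by rewrite eq_sym (negPf (adj_neq xy)) => /esym/eqP.
Qed.

Lemma card_incident x : #|incident x| = deg x.
Proof. by rewrite incidentE card_in_imset //; apply: set2_adj_inj. Qed.

(** Double counting of the pairs (x, A) with x an end of the edge A. *)
Lemma handshake : (\sum_(x : G) deg x = 2 * #|edges G|)%N.
Proof.
under eq_bigr => x _ do rewrite -card_incident -sum1_card.
rewrite (exchange_big_dep (mem (edges G))) /=; last first.
  by move=> x A _; rewrite inE => /andP[].
rewrite -sum1_card big_distrr /=; apply: eq_bigr => A AE.
under eq_bigl => x do rewrite inE AE /=.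
by rewrite sum1_card; case/edgesP: AE => u [v [uv ->]]; rewrite cards2 adj_neq.
Qed.

Lemma card_avoiding x : #|edges G :\: incident x| = (#|edges G| - deg x)%N.
Proof.
rewrite -card_incident cardsD; congr (_ - #|pred_of_set _|)%N.
by apply/setIidPr/subsetP => A; rewrite inE => /andP[].
Qed.

(** Among the edges at y, only {x, y} can contain x; all others avoid x. *)
Lemma deg_le_avoiding x y : x != y -> (deg y <= (#|edges G| - deg x).+1)%N.
Proof.
move=> xy; rewrite -card_avoiding -card_incident -add1n -(cards1 [set x; y]).
apply: leq_trans (leq_card_setU _ _); apply: subset_leq_card.
apply/subsetP => A; rewrite !inE => /andP[AE yA]; rewrite AE andbT /=.
case: (boolP (x \in A)) => xA; last by rewrite orbT.
rewrite orbF; case/edgesP: AE xA yA => u [v [uv ->]]; rewrite !inE.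
move=> /orP[]/eqP xe /orP[]/eqP ye; subst=> //; rewrite ?eqxx // in xy *.
by rewrite setUC.
Qed.

Lemma deg_gt0 u v : adj u v -> (0 < deg u)%N.
Proof. by move=> uv; apply/card_gt0P; exists v; rewrite inE. Qed.

Variable R : realType.

Definition ASO_term A : R :=
  Num.sqrt ((\sum_(v in A) (deg v)%:R ^+ 2)
              / ((\sum_(v in A) (deg v)%:R) - 2)).

Lemma ASO_term_set2 u v : adj u v ->
  ASO_term [set u; v] = edge_weight R (deg u) (deg v).
Proof.
by move=> uv; rewrite /ASO_term !big_setU1 ?inE ?adj_neq //= !big_set1.
Qed.

(** Used at a vertex of degree n - 1 or n - 2, where the second sum has only one or two terms. *)
Lemma ASO_split x :
  ASO R G = \sum_(y in [set y | adj x y]) edge_weight R (deg x) (deg y)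
            + \sum_(A in edges G :\: incident x) ASO_term A.
Proof.
rewrite {1}/ASO (big_setID (incident x)) /=; congr (_ + _).
rewrite (_ : edges G :&: incident x = incident x); last first.
  by apply/setIidPr/subsetP => A; rewrite inE => /andP[].
rewrite incidentE (big_imset _ (@set2_adj_inj x)) /=.
by apply: eq_bigr => y; rewrite inE; exact: ASO_term_set2.
Qed.

Lemma ASO_term_le D A : (2 < D)%N -> A \in edges G ->
  (forall v, v \in A -> (deg v <= D)%N) -> ASO_term A <= edge_weight R 1 D.
Proof.
move=> D2 /edgesP[u [v [uv ->]]] hD; rewrite ASO_term_set2 //.
apply: edge_weight_le => //.
  by rewrite (deg_gt0 uv) hD // !inE eqxx.
by rewrite (@deg_gt0 v u) 1?adj_sym // hD // !inE eqxx orbT.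
Qed.

End Edges.

Lemma sum_le_card (R : realType) (T : finType) (S : {set T}) (F : T -> R) c :
  (forall i, i \in S -> F i <= c) -> \sum_(i in S) F i <= #|S|%:R * c.
Proof.
by move=> h; rewrite mulr_natl -sumr_const; apply: ler_sum => i /h.
Qed.

(** * Graphs with n = [m.+3] vertices and n edges *)

Section Unicyclic.
Variables (G : sgraph) (m : nat).
Hypotheses (hV : #|G| = m.+3) (hE : #|edges G| = m.+3).

(** The nonnegative deficits 2 - deg y add up to 2 |V| - 2 |E| = 0, so each of them is 0. *)
Lemma deg_eq2 : (forall x : G, deg x <= 2)%N -> forall x : G, deg x = 2%N.
Proof.
move=> h2 x; have : (\sum_(y : G) (2 - deg y) == 0)%N.
  rewrite sumnB // handshake hE sum_nat_const /= -hV mulnC subn_eq0.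
  by rewrite hV.
rewrite sum_nat_eq0 => /forallP/(_ x) /=; rewrite subn_eq0 => hx.
by apply/eqP; rewrite eqn_leq h2.
Qed.

Lemma ASO_lt_bound (R : realType) : (forall x : G, deg x <= m.+1)%N ->
  ASO R G < m%:R * edge_weight R 1 m.+2 + 2 * edge_weight R 2 m.+2 + 2.
Proof.
move=> hD.
have [/forallP h2|] := boolP [forall x : G, deg x <= 2]%N.
  have d2 := deg_eq2 h2.
  have m0 : (0 < m)%N.
    have /card_gt0P[x _] : (0 < #|G|)%N by rewrite hV.
    by have := hD x; rewrite d2 ltnS.
  apply: le_lt_trans (bound_gt_cycle R m0).
  rewrite mulrC -(natrD _ m 3) addn3 -hE; apply: sum_le_card => A.
  case/edgesP=> u [v [uv ->]].
  by rewrite -[leLHS]/(ASO_term R _) ASO_term_set2 // !d2 edge_weight22.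
rewrite negb_forall => /existsP[z]; rewrite -ltnNge => z2.
have m1 : (1 < m)%N by have := hD z; lia.
(* A vertex x of degree n - 2 leaves two edges avoiding it, and by [deg_le_avoiding] their ends have
   degree at most 2 + 1. *)
have [/existsP[x /eqP dx]|] := boolP [exists x : G, deg x == m.+1].
  apply: le_lt_trans (bound_gt_large_deg R m1).
  rewrite (ASO_split _ x) natr1; apply: lerD.
    rewrite -{1}dx; apply: sum_le_card => y; rewrite inE => xy.
    rewrite dx; apply: edge_weight_le; rewrite ?leqnn ?ltnS //.
    by rewrite hD (@deg_gt0 _ y x) // adj_sym.
  have -> : (2 : R) = #|edges G :\: incident x|%:R.
    by rewrite card_avoiding hE dx; congr _%:R; lia.
  rewrite -edge_weight13; apply: sum_le_card => A.
  rewrite !inE => /andP[xA AE]; apply: ASO_term_le => // v vA.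
  have xv : x != v by apply: contraNneq xA => ->; rewrite AE.
  by apply: leq_trans (deg_le_avoiding xv) _; rewrite hE dx; lia.
rewrite negb_exists => /forallP hne.
have {}hD (x : G) : (deg x <= m)%N.
  by have := hD x; rewrite leq_eqVlt (negPf (hne x)).
(* The vertex z of degree at least 3 makes n - 3 an admissible degree bound for [ASO_term_le]. *)
have m2 : (2 < m)%N by apply: leq_trans (hD z).
apply: le_lt_trans (bound_gt_small_deg R m2).
rewrite -(natrD _ m 3) addn3 -hE; apply: sum_le_card => A AE.
by apply: (@ASO_term_le _ R).
Qed.

(** * Graphs with a vertex of degree n - 1 *)

Lemma dominating_structure (x : G) : deg x = m.+2 ->
  exists u v : G, [/\ x != u, x != v, u != v,
    edges G :\: incident x = [set [set u; v]] &
    forall y z : G, adj y z =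
      [|| (y == x) && (z != x), (z == x) && (y != x),
          (y == u) && (z == v) | (z == u) && (y == v)]].
Proof.
move=> dx.
have /eqP/cards1P[A eA] : #|edges G :\: incident x| = 1%N.
  by rewrite card_avoiding hE dx subSnn.
have : A \in edges G :\: incident x by rewrite eA inE.
rewrite !inE => /andP[xA AE]; rewrite AE /= in xA.
case/edgesP: AE => u [v [uv Auv]].
have := xA; rewrite {1}Auv !inE negb_or => /andP[xu xv].
have nuv := adj_neq uv.
have xadj y : adj x y = (y != x).
  have /eqP e : [set y | adj x y] == [set~ x].
    rewrite eqEcard cardsC1 hV -/(deg x) dx leqnn andbT.
    by apply/subsetP => w; rewrite !inE => /adj_neq; rewrite eq_sym.
  by have /setP/(_ y) := e; rewrite !inE.
exists u, v; split=> //; first by rewrite eA Auv.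
move=> y z; have [->|yx] := eqVneq y x.
  by rewrite xadj (negPf xu) (negPf xv) !andbF !orbF.
have [->|zx] := eqVneq z x.
  by rewrite adj_sym xadj yx.
(* A pair away from x is an edge exactly when it is the single edge {u, v} avoiding x. *)
rewrite /= -mem_edges.
have -> : ([set y; z] \in edges G) = ([set y; z] \in edges G :\: incident x).
  by rewrite !inE !(eq_sym x) (negPf yx) (negPf zx) andbF.
rewrite eA Auv inE; apply/eqP/orP => [/setP e|].
  have := e u; have := e v; have := e y; have := e z; rewrite !inE !eqxx !orbT /=.
  move=> /esym/orP[]/eqP-> /esym/orP[]/eqP->.
  - by rewrite (eq_sym v) (negPf nuv).
  - by rewrite !eqxx; right.
  - by rewrite !eqxx; left.
  - by rewrite (negPf nuv).
by case=> /andP[/eqP-> /eqP->] //; rewrite setUC.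
Qed.

Lemma dominating_ASO (R : realType) (x : G) : deg x = m.+2 ->
  ASO R G = m%:R * edge_weight R 1 m.+2 + 2 * edge_weight R 2 m.+2 + 2.
Proof.
move=> dx; have [u [v [xu xv uv eE eadj]]] := dominating_structure dx.
have [ux vx vu] : [/\ u != x, v != x & v != u] by split; rewrite eq_sym.
have du : deg u = 2%N.
  rewrite /deg (_ : [set w | _] = [set x; v]) ?cards2 ?xv //.
  by apply/setP => w; rewrite !inE eadj eqxx (negPf ux) (negPf uv) andbT andbF orbF.
have dv : deg v = 2%N.
  rewrite /deg (_ : [set w | _] = [set x; u]) ?cards2 ?xu //.
  by apply/setP => w; rewrite !inE eadj eqxx (negPf vx) (negPf vu) !andbT.
have dy y : y != x -> y != u -> y != v -> deg y = 1%N.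
  move=> yx yu yv; rewrite /deg (_ : [set w | _] = [set x]) ?cards1 //.
  apply/setP => w; rewrite !inE eadj (negPf yx) (negPf yu) (negPf yv).
  by rewrite !andbF andbT !orbF.
rewrite (ASO_split _ x) eE big_set1 ASO_term_set2; last first.
  by rewrite eadj !eqxx !orbT.
rewrite du dv edge_weight22; congr (_ + _).
have uS : u \in [set y | adj x y] by rewrite inE eadj eqxx ux.
have vS : v \in [set y | adj x y] :\ u by rewrite !inE vu eadj eqxx vx.
have cS : #|[set y | adj x y] :\ u :\ v| = m.
  by have := dx; rewrite /deg (cardsD1 u) (cardsD1 v _) uS vS => -[].
(* Without u and v, the neighbours of x are the m = n - 3 pendant vertices. *)
rewrite (big_setD1 u) //= (big_setD1 v) //= du dv dx.
rewrite (eq_bigr (fun=> edge_weight R 1 m.+2)); last first.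
  move=> y; rewrite !inE => /and3P[yv yu /adj_neq]; rewrite eq_sym => yx.
  by rewrite (dy y) // edge_weightC.
by rewrite sumr_const cS edge_weightC -[_ *+ m]mulr_natl; ring.
Qed.

Lemma dominating_isomorphic (x : G) : deg x = m.+2 ->
  isomorphic G (star_plus m.+3).
Proof.
move=> dx; have [u [v [xu xv uv _ eadj]]] := dominating_structure dx.
(* Listing x, u, v first makes the index in [s] send x to the centre 0 and u, v to the joined leaves
   1, 2. *)
pose s := x :: u :: v :: [seq y <- enum G | y \notin [:: x; u; v]].
have us : uniq s.
  rewrite /= !inE !negb_or xu xv uv !mem_filter !inE !eqxx !orbT /=.
  exact/filter_uniq/enum_uniq.
have ms y : y \in s.
  by rewrite !inE mem_filter mem_enum !inE; do 3!case: (y == _).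
have ss : size s = m.+3.
  by rewrite -(card_uniqP us) -hV; apply: eq_card => y; rewrite ms.
have lts y : (index y s < m.+3)%N by rewrite -ss index_mem.
have is_inj y z : (index y s == index z s) = (y == z).
  by apply/eqP/eqP => [/index_inj|->] //; apply.
have ix y : (index y s == 0)%N = (y == x).
  by rewrite -is_inj /= eqxx.
have iu y : (index y s == 1)%N = (y == u).
  by rewrite -is_inj /= (negPf xu) eqxx.
have iv y : (index y s == 2)%N = (y == v).
  by rewrite -is_inj /= (negPf xv) (negPf uv) eqxx.
exists (fun y => Ordinal (lts y)); last first.
  by move=> y z; rewrite /= /star_plus_adj /= eadj !ix !iu !iv.
apply: inj_card_bij; last by rewrite card_ord hV.
by move=> y z [] /eqP; rewrite is_inj => /eqP.
Qed.

(** The preimage of the centre 0 is adjacent to every other vertex. *)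
Lemma isomorphic_dominating : isomorphic G (star_plus m.+3) ->
  exists x : G, deg x = m.+2.
Proof.
case=> f [g gf fg] fadj; exists (g ord0).
transitivity #|[set~ g ord0]|; last by rewrite cardsC1 hV.
apply: eq_card => y; rewrite !inE -fadj fg /= /star_plus_adj /= !andbF /= !orbF.
by congr (~~ _); rewrite -(can_eq gf) fg.
Qed.

End Unicyclic.

Theorem theorem1 (R : realType) (n : nat) (G : sgraph) (hn : (3 <= n)%N)
    (hGn : #|G| = n) (hG : unicyclic G) :
  let bound : R :=
    (n%:R - 3) * Num.sqrt (n%:R + 2 / (n%:R - 2))
    + 2 * Num.sqrt (n%:R - 1 + 4 / (n%:R - 1)) + 2 in
  ASO R G <= bound /\ (ASO R G = bound <-> isomorphic G (star_plus n)).
Proof.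
case: n hn hGn => [|[|[|m]]] // _ hV bound.
have hE : #|edges G| = m.+3 by case: hG => _ ->.
have -> : bound = m%:R * edge_weight R 1 m.+2 + 2 * edge_weight R 2 m.+2 + 2.
  by rewrite edge_weight1E edge_weight2E /bound -(addn3 m) natrD addrK.
(* A vertex of degree n - 1 gives both equality and the isomorphism; without one, the inequality is
   strict and no isomorphism exists. *)
have [/existsP[x /eqP dx]|] := boolP [exists x : G, deg x == m.+2].
  have iso := dominating_isomorphic hV hE dx.
  by rewrite (dominating_ASO hV hE R dx).
rewrite negb_exists => /forallP hne.
have hD (x : G) : (deg x <= m.+1)%N.
  rewrite -ltnS ltn_neqAle hne /=.
  have <- : #|[set~ x]| = m.+2 by rewrite cardsC1 hV.
  apply/subset_leq_card/subsetP => y; rewrite !inE => /adj_neq.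
  by rewrite eq_sym.
have lt := ASO_lt_bound hV hE R hD; split; first exact: ltW.
split=> [eq|/(isomorphic_dominating hV)[x dx]]; first by rewrite eq ltxx in lt.
by have := hne x; rewrite dx eqxx.
Qed.
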